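(* For arbitrarily large integers $n$ there exist (families of) feasible $n$-node graphs with election index $1$ such that leader election in time $1$ in these graphs requires advice of size $\Omega(n\log\log n)$. Precisely: there is a constant $c>0$ such that for infinitely many integers $n$ there is a finite family $\mathcal{F}_n$ of feasible $n$-node graphs, each with election index $1$, such that for every deterministic leader election algorithm with advice that performs leader election in time $1$ in every graph of $\mathcal{F}_n$, some graph of $\mathcal{F}_n$ receives advice of length at least $c\, n\log\log n$.
   Context: A graph is a simple undirected connected finite graph whose nodes have no identifiers; at each node $v$ of degree $d$ the incident edges carry distinct port numbers $0,\dots,d-1$ (local to each node). The truncated view $\mathcal{V}^0(v)$ is a single node; $\mathcal{V}^{l+1}(v)$ is the port-labelled rooted tree whose root has, for every neighbour $v_i$ of $v$, a child $x_i$ joined by an edge carrying the same two port numbers as $\{v,v_i\}$ (the one at $v$ at the root side), and $x_i$ is the root of a copy of $\mathcal{V}^l(v_i)$. The augmented truncated view $\mathcal{B}^l(v)$ is $\mathcal{V}^l(v)$ with each leaf labelled by the degree in $G$ of the node it represents. A graph is feasible if for some $l$ the views $\mathcal{B}^l(v)$ of all nodes are pairwise distinct; its election index is the smallest such $l$. Model (LOCAL): synchronous rounds, all nodes start simultaneously, in each round every node exchanges arbitrary messages with all neighbours and computes arbitrarily. Leader election: every node $v$ outputs a sequence $(p_1,q_1,\dots,p_k,q_k)$ of nonnegative integers describing a simple path starting at $v$ whose $i$-th edge has port $p_i$ at its endpoint closer to $v$ and $q_i$ at the other endpoint; all these paths must end at a common node. Time is the number of rounds until all nodes output. Advice: an oracle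 knowing the entire port-labelled graph gives the same binary string to all nodes before the start; its length is the size of advice. In a deterministic algorithm with advice, the actions/output of node $v$ in round $r$ are a function of the advice and of $\mathcal{B}^r(v)$. Logarithms are base 2. *)

(* Defs.v *)
From Stdlib Require Import Reals List Arith.
Import ListNotations.

(* A port-labelled graph with nodes 0..gn-1.  [adj v] lists, in port order,
   the edges at v: the entry at position p is (u, q), meaning that the edge
   with port p at v leads to node u, where it has port q.  deg v = length (adj v). *)
Record pgraph := PGraph { gn : nat ; adj : nat -> list (nat * nat) }.

Definition deg (G : pgraph) (v : nat) : nat := length (adj G v).

Inductive reach (G : pgraph) : nat -> nat -> Prop :=
| reach_refl v : reach G v v
| reach_step v p u q w : nth_error (adj G v) p = Some (u, q) -> reach G u w -> reach G v w.

Definition wf_graph (G : pgraph) : Prop :=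
  (forall v p u q, v < gn G -> nth_error (adj G v) p = Some (u, q) ->
     u < gn G /\ u <> v /\ nth_error (adj G u) q = Some (v, p)) /\
  (forall v p1 p2 u1 q1 u2 q2, v < gn G ->
     nth_error (adj G v) p1 = Some (u1, q1) ->
     nth_error (adj G v) p2 = Some (u2, q2) -> u1 = u2 -> p1 = p2) /\
  (forall u v, u < gn G -> v < gn G -> reach G u v).

(* Augmented truncated views: leaves labelled by degree; an internal node
   lists its children in port order, each child tagged with the pair of
   port numbers (port at the parent side, port at the child side). *)
Inductive view : Type :=
| VLeaf : nat -> view
| VNode : list (nat * nat * view) -> view.

Fixpoint aview (G : pgraph) (l : nat) (v : nat) : view :=
  match l with
  | 0 => VLeaf (deg G v)
  | S l' => VNode (map (fun '(p, (u, q)) => (p, q, aview G l' u))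
                       (combine (seq 0 (deg G v)) (adj G v)))
  end.

Definition distinct_views (G : pgraph) (l : nat) : Prop :=
  forall u v, u < gn G -> v < gn G -> aview G l u = aview G l v -> u = v.

Definition feasible (G : pgraph) : Prop := exists l, distinct_views G l.

Definition election_index (G : pgraph) (l : nat) : Prop :=
  distinct_views G l /\ forall l', l' < l -> ~ distinct_views G l'.

Fixpoint pairs (s : list nat) : option (list (nat * nat)) :=
  match s with
  | [] => Some []
  | p :: q :: t => option_map (cons (p, q)) (pairs t)
  | _ => None
  end.

Fixpoint walk (G : pgraph) (v : nat) (ps : list (nat * nat)) : option (list nat) :=
  match ps with
  | [] => Some []
  | (p, q) :: t =>
      match nth_error (adj G v) p with
      | Some (u, q') => if Nat.eqb q q' then option_map (cons u) (walk G u t) else None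
      | None => None
      end
  end.

Definition elects (G : pgraph) (out : nat -> list nat) : Prop :=
  exists w, forall v, v < gn G ->
    exists ps nodes, pairs (out v) = Some ps /\ walk G v ps = Some nodes /\
      NoDup (v :: nodes) /\ last (v :: nodes) v = w.

(* Algorithm with advice, time 1: the output of v is a function of the
   advice and of B^1(v). *)
Definition output_time1 (A : list bool -> view -> list nat) (adv : list bool)
  (G : pgraph) : nat -> list nat := fun v => A adv (aview G 1 v).

Definition log2 (x : R) : R := (ln x / ln 2)%R.

(* Main.v *)
Require Import Defs.
From Stdlib Require Import Reals List Arith.
From Stdlib Require Import Lia Lra.
Import ListNotations.

(* The graphs are rings of [k = m ^ m] cliques on [m + 1] nodes.  The [m]
   digits of [g < m ^ m] shift the port numberings inside clique [g], so that
   every node recognises itself and its clique at depth 1; but at that depth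
   the clique sees nothing of its neighbours on the ring.  Hence two graphs that
   differ only in the order of the cliques and receive the same advice have the
   same outputs.  The ports in the output of a clique's root give its distance
   along the ring to the leader, so the outputs determine the order up to
   rotation.  With [k ^ (k / 4)] or more orders the advice needs order of
   [k log k] bits, which is of order [n log log n] because [n = k (m + 1)] and
   [log k = m log m]. *)

(** * Base-[b] digits and arithmetic modulo [n] *)

Definition digit (b x i : nat) : nat := (x / b ^ i) mod b.

Lemma digit_lt b x i : 0 < b -> digit b x i < b.
Proof. intros; apply Nat.mod_upper_bound; lia. Qed.

Lemma digit_S b x i : digit b x (S i) = digit b (x / b) i.
Proof. unfold digit; rewrite Nat.Div0.div_div, Nat.pow_succ_r'; reflexivity. Qed.

Lemma digit_inj b r x y : 0 < b -> x < b ^ r -> y < b ^ r ->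
  (forall i, i < r -> digit b x i = digit b y i) -> x = y.
Proof.
  intros b0; revert x y; induction r as [|r IH]; simpl; intros x y hx hy e.
  - lia.
  - assert (E : x / b = y / b).
    { apply IH.
      - apply Nat.Div0.div_lt_upper_bound; lia.
      - apply Nat.Div0.div_lt_upper_bound; lia.
      - intros i hi; rewrite <- !digit_S; apply e; lia. }
    pose proof (e 0 ltac:(lia)) as e0; unfold digit in e0.
    rewrite Nat.pow_0_r, !Nat.div_1_r in e0.
    rewrite (Nat.div_mod_eq x b), (Nat.div_mod_eq y b), E, e0; reflexivity.
Qed.

(* Reduction modulo [n], for [a < 2 * n] only. *)
Definition wrap (n a : nat) : nat := if a <? n then a else a - n.

Ltac wrap_lia :=
  unfold wrap in *;
  repeat match goal with
  | |- context [?a <? ?b] => destruct (Nat.ltb_spec a b)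
  | H : context [?a <? ?b] |- _ => destruct (Nat.ltb_spec a b)
  end; lia.

Lemma wrap_mod n a : a < 2 * n -> wrap n a = a mod n.
Proof.
  intros h; unfold wrap; destruct (Nat.ltb_spec a n).
  - symmetry; apply Nat.mod_small; lia.
  - apply Nat.mod_unique with 1; lia.
Qed.

Lemma mod_add_inj k a b d : a < k -> b < k ->
  (a + d) mod k = (b + d) mod k -> a = b.
Proof.
  intros ha hb e.
  pose proof (Nat.div_mod_eq (a + d) k); pose proof (Nat.div_mod_eq (b + d) k).
  assert ((a + d) / k = (b + d) / k) by nia.
  nia.
Qed.

(** * Permutations encoded by digits *)

Definition swap (a b y : nat) : nat :=
  if y =? a then b else if y =? b then a else y.

Ltac swap_lia :=
  unfold swap in *;
  repeat match goal with
  | |- context [?a =? ?b] => destruct (Nat.eqb_spec a b)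
  | H : context [?a =? ?b] |- _ => destruct (Nat.eqb_spec a b)
  end; lia.

Lemma swapK a b y : swap a b (swap a b y) = y.
Proof. swap_lia. Qed.

Lemma swap_lt a b y k : a < k -> b < k -> y < k -> swap a b y < k.
Proof. swap_lia. Qed.

Record perm_below (k : nat) := PermBelow {
  pfun : nat -> nat;
  pinv : nat -> nat;
  pfun_lt : forall y, y < k -> pfun y < k;
  pinv_lt : forall y, y < k -> pinv y < k;
  pfunK : forall y, y < k -> pinv (pfun y) = y;
  pinvK : forall y, y < k -> pfun (pinv y) = y
}.

Arguments pfun {k}.
Arguments pinv {k}.

(* The digits of [x] in base [K] choose transpositions; all of them fix 0, which
   eliminates rotations. *)
Fixpoint swaps (K x i y : nat) : nat :=
  match i with
  | 0 => y
  | S i' => swap (K + 1 + i') (1 + digit K x i') (swaps K x i' y)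
  end.

Fixpoint swaps_inv (K x i y : nat) : nat :=
  match i with
  | 0 => y
  | S i' => swaps_inv K x i' (swap (K + 1 + i') (1 + digit K x i') y)
  end.

Lemma swapsK K x i y : swaps_inv K x i (swaps K x i y) = y.
Proof. induction i; simpl; rewrite ?swapK; auto. Qed.

Lemma swaps_invK K x i y : swaps K x i (swaps_inv K x i y) = y.
Proof. revert y; induction i; simpl; intros; rewrite ?IHi, ?swapK; auto. Qed.

Lemma swaps_lt K x i k y : 0 < K -> K + 1 + i <= k -> y < k -> swaps K x i y < k.
Proof.
  intros K0 hi hy; induction i as [|i IH]; cbn [swaps]; [easy|].
  pose proof (digit_lt K x i K0).
  apply swap_lt; [lia | lia | apply IH; lia].
Qed.

Lemma swaps_inv_lt K x i k y : 0 < K -> K + 1 + i <= k -> y < k -> swaps_inv K x i y < k.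
Proof.
  intros K0 hi; revert y; induction i as [|i IH]; cbn [swaps_inv]; intros y hy; [easy|].
  pose proof (digit_lt K x i K0).
  apply IH; [lia | apply swap_lt; lia].
Qed.

Lemma swaps_0 K x i : swaps K x i 0 = 0.
Proof. induction i as [|i IH]; cbn [swaps]; rewrite ?IH; swap_lia. Qed.

(** Transposition number [i'] exchanges [K + 1 + i'] with a point of [1 .. K], so each of the larger
    points waits for its own transposition. *)
Lemma swaps_fix K x i y : 0 < K -> K + 1 + i <= y -> swaps K x i y = y.
Proof.
  intros K0; induction i as [|i IH]; cbn [swaps]; intros hi; [easy|].
  pose proof (digit_lt K x i K0).
  rewrite IH by lia; swap_lia.
Qed.

(* The last transposition is read off the image of its larger point, which
   the previous ones fix. *)
Lemma swaps_digits K x x' i k : 0 < K -> K + 1 + i <= k ->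
  (forall y, y < k -> swaps K x i y = swaps K x' i y) ->
  forall j, j < i -> digit K x j = digit K x' j.
Proof.
  intros K0; induction i as [|i IH]; intros hi e j hj; [lia|].
  assert (E : digit K x i = digit K x' i).
  { specialize (e (K + 1 + i) ltac:(lia)); cbn [swaps] in e.
    rewrite !swaps_fix in e by lia. swap_lia. }
  destruct (Nat.eq_dec j i) as [->|ne]; [easy|].
  apply IH; [lia| |lia].
  intros y hy; specialize (e y hy); cbn [swaps] in e; rewrite E in e.
  apply (f_equal (swap (K + 1 + i) (1 + digit K x' i))) in e.
  now rewrite !swapK in e.
Qed.

(** The [2 * K] points are 0, the [K] partners [1 .. K] that a digit can select, and [K - 1] further
    points, one for each transposition. *)
Definition swap_perm (K x : nat) (K0 : 0 < K) : perm_below (2 * K).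
Proof.
  refine (PermBelow (2 * K) (swaps K x (K - 1)) (swaps_inv K x (K - 1)) _ _ _ _); intros y hy.
  - apply swaps_lt; lia.
  - apply swaps_inv_lt; lia.
  - apply swapsK.
  - apply swaps_invK.
(* Kept transparent: [pfun] of this permutation must later convert to [swaps]. *)
Defined.

(** * Depth-1 views and reachability in arbitrary graphs *)

(** The first port [a] is a parameter for the sake of induction on the list; views use [a = 0]. *)
Definition children (f : nat -> view) (a : nat) (l : list (nat * nat)) :=
  map (fun '(p, (u, q)) => (p, q, f u)) (combine (seq a (length l)) l).

Lemma nth_error_children f a l p :
  nth_error (children f a l) p =
  option_map (fun '(u, q) => (a + p, q, f u)) (nth_error l p).
Proof.
  unfold children.
  revert a p; induction l as [|[u q] l IH]; intros a [|p]; simpl; auto.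
  - now rewrite Nat.add_0_r.
  - rewrite IH; now replace (S a + p) with (a + S p) by lia.
Qed.

Lemma aview1E G v : aview G 1 v = VNode (children (fun u => VLeaf (deg G u)) 0 (adj G v)).
Proof. reflexivity. Qed.

Lemma aview1_edge G u v p x q : aview G 1 u = aview G 1 v ->
  nth_error (adj G u) p = Some (x, q) ->
  exists y, nth_error (adj G v) p = Some (y, q) /\ deg G x = deg G y.
Proof.
  rewrite !aview1E; intros E h; injection E as E.
  apply (f_equal (fun l => nth_error l p)) in E.
  rewrite !nth_error_children, h in E.
  destruct (nth_error (adj G v) p) as [[y q']|]; [|discriminate].
  injection E as -> E; eauto.
Qed.

Lemma aview1_ext G G' v : deg G v = deg G' v ->
  (forall p x q, nth_error (adj G v) p = Some (x, q) ->
     exists y, nth_error (adj G' v) p = Some (y, q) /\ deg G x = deg G' y) ->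
  aview G 1 v = aview G' 1 v.
Proof.
  intros hd h; rewrite !aview1E; f_equal; apply nth_error_ext; intros p.
  rewrite !nth_error_children.
  destruct (nth_error (adj G v) p) as [[x q]|] eqn:e.
  - destruct (h _ _ _ e) as (y & -> & E); simpl; now rewrite E.
  - apply nth_error_None in e; unfold deg in hd; rewrite hd in e.
    apply nth_error_None in e; now rewrite e.
Qed.

Lemma reach_trans G u v w : reach G u v -> reach G v w -> reach G u w.
Proof. induction 1; eauto using reach_step. Qed.

Lemma reach_edge G v p u q : nth_error (adj G v) p = Some (u, q) -> reach G v u.
Proof. eauto using reach_step, reach_refl. Qed.

(** * The ring of cliques and its port numbering *)

Section RingOfCliques.

Context (m k : nat) (s : perm_below k).

Definition enc (g j : nat) : nat := g * (m + 1) + j.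
Definition clique_of (v : nat) : nat := v / (m + 1).
Definition index_of (v : nat) : nat := v mod (m + 1).

Definition next (g : nat) : nat := pinv s (wrap k (pfun s g + 1)).
Definition prev (g : nat) : nat := pinv s (wrap k (pfun s g + (k - 1))).

(* Clique [g] has the nodes [enc g j] with [j <= m]; the one with [j = m] is its
   root.  Port [j] of the root leads to node [j].  At node [j], the port
   [digit m g j + d] (mod m) leads to the root if [d = 0], and to node [j + d]
   (mod m) otherwise.  The two further ports [m] and [m + 1] of the root belong
   to the ring, in which clique [g] has position [pfun s g]. *)
Definition edge (g j p : nat) : nat * nat :=
  if j =? m then
    if p <? m then (enc g p, digit m g p)
    else if p =? m then (enc (next g) m, m + 1)
    else (enc (prev g) m, m)
  else
    let d := wrap m (p + (m - digit m g j)) in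
    if d =? 0 then (enc g m, j)
    else let j' := wrap m (j + d) in (enc g j', wrap m (m - d + digit m g j')).

Definition ring_graph : pgraph :=
  PGraph (k * (m + 1))
    (fun v => map (edge (clique_of v) (index_of v))
                  (seq 0 (if index_of v =? m then m + 2 else m))).

(** Relational form of [edge]. Edges between inner nodes are indexed by their offset [d] rather than
    by their port, so that case analysis yields [d] directly. *)
Inductive edge_case (g j : nat) : nat -> nat -> nat -> Prop :=
| EdgeDown p : j = m -> p < m -> edge_case g j p (enc g p) (digit m g p)
| EdgeNext : j = m -> edge_case g j m (enc (next g) m) (m + 1)
| EdgePrev : j = m -> edge_case g j (m + 1) (enc (prev g) m) m
| EdgeUp : j < m -> edge_case g j (digit m g j) (enc g m) j
| EdgeSide d : j < m -> 0 < d < m ->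
    edge_case g j (wrap m (digit m g j + d)) (enc g (wrap m (j + d)))
      (wrap m (m - d + digit m g (wrap m (j + d)))).

Lemma clique_of_enc g j : j <= m -> clique_of (enc g j) = g.
Proof.
  intros; unfold clique_of, enc; rewrite Nat.div_add_l, Nat.div_small by lia; lia.
Qed.

Lemma index_of_enc g j : j <= m -> index_of (enc g j) = j.
Proof.
  intros; unfold index_of, enc.
  rewrite Nat.add_comm, Nat.Div0.mod_add; apply Nat.mod_small; lia.
Qed.

Lemma enc_inj g j g' j' : j <= m -> j' <= m -> enc g j = enc g' j' -> g = g' /\ j = j'.
Proof.
  intros h h' e; split.
  - rewrite <- (clique_of_enc g j h), e; now apply clique_of_enc.
  - rewrite <- (index_of_enc g j h), e; now apply index_of_enc.
Qed.

Lemma enc_lt g j : g < k -> j <= m -> enc g j < gn ring_graph.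
Proof. unfold enc; simpl; nia. Qed.

Lemma enc_surj v : v < gn ring_graph -> exists g j, g < k /\ j <= m /\ v = enc g j.
Proof.
  intros h; exists (clique_of v), (index_of v); repeat split.
  - apply Nat.Div0.div_lt_upper_bound; simpl in h; lia.
  - assert (index_of v < m + 1) by (apply Nat.mod_upper_bound; lia); lia.
  - unfold enc, clique_of, index_of; rewrite (Nat.div_mod_eq v (m + 1)) at 1; lia.
Qed.

Lemma deg_enc g j : j <= m -> deg ring_graph (enc g j) = if j =? m then m + 2 else m.
Proof.
  intros; unfold deg; simpl; now rewrite length_map, length_seq, index_of_enc.
Qed.

Lemma deg_root g : deg ring_graph (enc g m) = m + 2.
Proof. now rewrite deg_enc, Nat.eqb_refl. Qed.

Lemma deg_inner g j : j < m -> deg ring_graph (enc g j) = m.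
Proof. intros; rewrite deg_enc by lia; destruct (Nat.eqb_spec j m); lia. Qed.

Lemma nth_error_adj g j p : j <= m ->
  nth_error (adj ring_graph (enc g j)) p =
  if p <? (if j =? m then m + 2 else m) then Some (edge g j p) else None.
Proof.
  intros h; simpl; rewrite clique_of_enc, index_of_enc by lia.
  rewrite nth_error_map, nth_error_seq.
  now destruct (p <? _).
Qed.

Lemma adjP g j p u q : j <= m ->
  nth_error (adj ring_graph (enc g j)) p = Some (u, q) <-> edge_case g j p u q.
Proof.
  intros h; rewrite nth_error_adj by easy; unfold edge; split.
  - destruct (Nat.eqb_spec j m) as [->|ne].
    + destruct (Nat.ltb_spec p (m + 2)); [|discriminate].
      destruct (Nat.ltb_spec p m).
      { intros [= <- <-]; now constructor. }
      destruct (Nat.eqb_spec p m) as [->|].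
      { intros [= <- <-]; now constructor. }
      intros [= <- <-]; replace p with (m + 1) by lia; now constructor.
    + destruct (Nat.ltb_spec p m); [|discriminate].
      pose proof (digit_lt m g j ltac:(lia)).
      set (d := wrap m _).
      assert (hd : d < m /\ p = wrap m (digit m g j + d)) by (unfold d; wrap_lia).
      clearbody d; destruct hd as [hd ->].
      destruct (Nat.eqb_spec d 0) as [->|]; intros [= <- <-].
      * replace (wrap m (digit m g j + 0)) with (digit m g j) by wrap_lia.
        constructor; lia.
      * constructor; lia.
  - intros [p' | | | | d]; subst; rewrite ?Nat.eqb_refl.
    + destruct (Nat.ltb_spec p' (m + 2)); [|lia].
      destruct (Nat.ltb_spec p' m); [easy|lia].
    + destruct (Nat.ltb_spec m (m + 2)); [|lia].
      now rewrite Nat.ltb_irrefl.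
    + destruct (Nat.ltb_spec (m + 1) (m + 2)); [|lia].
      destruct (Nat.ltb_spec (m + 1) m); [lia|].
      destruct (Nat.eqb_spec (m + 1) m); [lia|easy].
    + destruct (Nat.eqb_spec j m); [lia|].
      pose proof (digit_lt m g j ltac:(lia)).
      destruct (Nat.ltb_spec (digit m g j) m); [|lia].
      now replace (wrap m (digit m g j + (m - digit m g j))) with 0 by wrap_lia.
    + destruct (Nat.eqb_spec j m); [lia|].
      pose proof (digit_lt m g j ltac:(lia)).
      destruct (Nat.ltb_spec (wrap m (digit m g j + d)) m); [|wrap_lia].
      replace (wrap m (wrap m (digit m g j + d) + (m - digit m g j))) with d by wrap_lia.
      destruct (Nat.eqb_spec d 0); [lia|easy].
Qed.

(** * Well-formedness: neighbours on the ring, symmetry, simplicity, connectedness *)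

Lemma next_lt g : g < k -> next g < k.
Proof.
  intros h; pose proof (pfun_lt k s g h); apply pinv_lt; wrap_lia.
Qed.

Lemma prev_lt g : g < k -> prev g < k.
Proof.
  intros h; pose proof (pfun_lt k s g h); apply pinv_lt; wrap_lia.
Qed.

Lemma pos_next g : g < k -> pfun s (next g) = wrap k (pfun s g + 1).
Proof.
  intros h; pose proof (pfun_lt k s g h); apply pinvK; wrap_lia.
Qed.

Lemma pos_prev g : g < k -> pfun s (prev g) = wrap k (pfun s g + (k - 1)).
Proof.
  intros h; pose proof (pfun_lt k s g h); apply pinvK; wrap_lia.
Qed.

Lemma prev_next g : g < k -> prev (next g) = g.
Proof.
  intros h; pose proof (pfun_lt k s g h); unfold prev; rewrite pos_next by easy.
  replace (wrap k (wrap k (pfun s g + 1) + (k - 1))) with (pfun s g) by wrap_lia.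
  now apply pfunK.
Qed.

Lemma next_prev g : g < k -> next (prev g) = g.
Proof.
  intros h; pose proof (pfun_lt k s g h); unfold next; rewrite pos_prev by easy.
  replace (wrap k (wrap k (pfun s g + (k - 1)) + 1)) with (pfun s g) by wrap_lia.
  now apply pfunK.
Qed.

Lemma ring_graph_sym g j p u q : 3 <= k -> g < k -> j <= m ->
  edge_case g j p u q ->
  u < gn ring_graph /\ u <> enc g j /\ nth_error (adj ring_graph u) q = Some (enc g j, p).
Proof.
  intros k3 hg hj [].
  - subst j; split; [|split].
    + apply enc_lt; lia.
    + intros e; apply enc_inj in e; lia.
    + apply adjP; [lia|]; now constructor.
  - subst j; pose proof (next_lt g hg); split; [|split].
    + apply enc_lt; lia.
    + intros e; apply enc_inj in e; try lia.
      pose proof (pos_next g hg) as E; destruct e as [e _]; rewrite e in E.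
      pose proof (pfun_lt k s g hg); wrap_lia.
    + apply adjP; [lia|]; rewrite <- (prev_next g hg) at 2; now constructor.
  - subst j; pose proof (prev_lt g hg); split; [|split].
    + apply enc_lt; lia.
    + intros e; apply enc_inj in e; try lia.
      pose proof (pos_prev g hg) as E; destruct e as [e _]; rewrite e in E.
      pose proof (pfun_lt k s g hg); wrap_lia.
    + apply adjP; [lia|]; rewrite <- (next_prev g hg) at 2; now constructor.
  - split; [|split].
    + apply enc_lt; lia.
    + intros e; apply enc_inj in e; lia.
    + apply adjP; [lia|]; now constructor.
  - assert (hw : wrap m (j + d) < m) by wrap_lia.
    split; [|split].
    + apply enc_lt; lia.
    + intros e; apply enc_inj in e; wrap_lia.
    + apply adjP; [lia|].
      (* Seen from the far end, the same edge has offset [m - d]. *)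
      assert (ej : wrap m (wrap m (j + d) + (m - d)) = j) by wrap_lia.
      pose proof (EdgeSide g (wrap m (j + d)) (m - d) hw ltac:(lia)) as E.
      rewrite ej in E.
      replace (m - (m - d) + digit m g j) with (digit m g j + d) in E by lia.
      now rewrite (Nat.add_comm (m - d)).
Qed.

Lemma ring_graph_simple g j p1 p2 u q1 q2 : 3 <= k -> g < k -> j <= m ->
  edge_case g j p1 u q1 -> edge_case g j p2 u q2 -> p1 = p2.
Proof.
  intros k3 hg hj h1 h2.
  (* Positions one ahead and one behind differ modulo [k] because [3 <= k]; for [k = 2] they would
     coincide. *)
  assert (hnp : next g <> prev g).
  { intros e; pose proof (pos_next g hg); pose proof (pos_prev g hg).
    pose proof (pfun_lt k s g hg); rewrite e in *; wrap_lia. }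
  destruct h1; inversion h2; subst; try lia;
    match goal with e : enc _ _ = enc _ _ |- _ => apply enc_inj in e end; wrap_lia.
Qed.

Lemma reach_root_zero i : i < k -> reach ring_graph (enc (pinv s i) m) (enc (pinv s 0) m).
Proof.
  induction i as [|i IH]; intros hi; [constructor|].
  apply reach_trans with (2 := IH ltac:(lia)).
  apply reach_edge with (m + 1) m; apply adjP; [lia|].
  replace (pinv s i) with (prev (pinv s (S i))); [now constructor|].
  unfold prev; rewrite pinvK by easy; f_equal; wrap_lia.
Qed.

Lemma reach_zero_root i : i < k -> reach ring_graph (enc (pinv s 0) m) (enc (pinv s i) m).
Proof.
  induction i as [|i IH]; intros hi; [constructor|].
  apply reach_trans with (1 := IH ltac:(lia)).
  apply reach_edge with m (m + 1); apply adjP; [lia|].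
  replace (pinv s (S i)) with (next (pinv s i)); [now constructor|].
  unfold next; rewrite pinvK by lia; f_equal; wrap_lia.
Qed.

Lemma reach_up g j : j <= m -> reach ring_graph (enc g j) (enc g m).
Proof.
  intros h; destruct (Nat.eq_dec j m) as [->|ne]; [constructor|].
  apply reach_edge with (digit m g j) j; apply adjP; [lia|]; constructor; lia.
Qed.

Lemma reach_down g j : j <= m -> reach ring_graph (enc g m) (enc g j).
Proof.
  intros h; destruct (Nat.eq_dec j m) as [->|ne]; [constructor|].
  apply reach_edge with j (digit m g j); apply adjP; [lia|]; constructor; lia.
Qed.

Lemma wf_ring_graph : 3 <= k -> wf_graph ring_graph.
Proof.
  intros k3; split; [|split].
  - intros v p u q hv h; destruct (enc_surj v hv) as (g & j & hg & hj & ->).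
    apply adjP in h; [|easy]; eauto using ring_graph_sym.
  - intros v p1 p2 u1 q1 u2 q2 hv h1 h2 <-.
    destruct (enc_surj v hv) as (g & j & hg & hj & ->).
    apply adjP in h1, h2; eauto using ring_graph_simple.
  - intros u v hu hv.
    destruct (enc_surj u hu) as (g & j & hg & hj & ->).
    destruct (enc_surj v hv) as (g' & j' & hg' & hj' & ->).
    apply reach_trans with (1 := reach_up g j hj).
    apply reach_trans with (2 := reach_down g' j' hj').
    pose proof (reach_root_zero _ (pfun_lt k s g hg)) as h; rewrite pfunK in h by easy.
    pose proof (reach_zero_root _ (pfun_lt k s g' hg')) as h'; rewrite pfunK in h' by easy.
    eauto using reach_trans.
Qed.

(** * Election index 1 *)

(* A node sees its index as the far port of its edge to the root, which it
   recognises by the degree, and then all digits of its clique from the other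
   far ports. *)
Lemma distinct_views_ring_graph : k <= m ^ m -> distinct_views ring_graph 1.
Proof.
  intros hk u v hu hv E.
  destruct (enc_surj u hu) as (g & j & hg & hj & ->).
  destruct (enc_surj v hv) as (g' & j' & hg' & hj' & ->).
  assert (view : forall p x q, edge_case g j p x q ->
    exists y, edge_case g' j' p y q /\ deg ring_graph x = deg ring_graph y).
  { intros p x q h; apply adjP in h; [|easy].
    destruct (aview1_edge _ _ _ _ _ _ E h) as (y & hy & hd).
    apply adjP in hy; eauto. }
  assert (inj : 0 < m -> (forall i, i < m -> digit m g i = digit m g' i) -> g = g').
  { intros; apply digit_inj with m m; auto; lia. }
  destruct (Nat.eq_dec j m) as [->|hjm].
  - destruct (view _ _ _ (EdgePrev g m eq_refl)) as (y & hy & _).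
    assert (j' = m) as ->.
    { inversion hy; try easy; pose proof (digit_lt m g' j' ltac:(lia)); wrap_lia. }
    (* For [m = 0] the bound [m ^ m = 1] leaves a single clique. *)
    destruct (Nat.eq_dec m 0) as [m0|m0]; [rewrite m0 in hk; simpl in hk; f_equal; lia|].
    f_equal; apply inj; [lia|]; intros i hi.
    destruct (view _ _ _ (EdgeDown g m i eq_refl hi)) as (z & hz & _).
    inversion hz; subst; lia.
  - destruct (view _ _ _ (EdgeUp g j ltac:(lia))) as (y & hy & hd).
    pose proof (digit_lt m g j ltac:(lia)) as hdig.
    rewrite deg_root in hd.
    assert (j' = j /\ digit m g' j = digit m g j) as [-> edig].
    { inversion hy; subst; try lia.
      - rewrite deg_inner in hd; lia.
      - rewrite deg_inner in hd by wrap_lia; lia. }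
    f_equal; apply inj; [lia|]; intros i hi.
    destruct (Nat.eq_dec i j) as [->|nij]; [easy|].
    (* The offset from node [j] to node [i]: the far port of that edge is digit [i] shifted by the
       known amount [m - d]. *)
    set (d := wrap m (i + (m - j))).
    assert (hdm : 0 < d < m) by (unfold d; wrap_lia).
    assert (ei : wrap m (j + d) = i) by (unfold d; wrap_lia).
    destruct (view _ _ _ (EdgeSide g j d ltac:(lia) hdm)) as (z & hz & _).
    clearbody d; pose proof (digit_lt m g i ltac:(lia)); pose proof (digit_lt m g' i ltac:(lia)).
    inversion hz as [ | | | |d']; try (exfalso; wrap_lia).
    assert (d' = d) as -> by wrap_lia.
    rewrite ei in *; wrap_lia.
Qed.

(** Depth 0 shows only degrees, and the roots of cliques 0 and 1 both have degree [m + 2]. *)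
Lemma election_index_ring_graph : 2 <= k -> k <= m ^ m -> election_index ring_graph 1.
Proof.
  intros k2 hk; split; [now apply distinct_views_ring_graph|].
  intros l hl h; assert (l = 0) as -> by lia.
  specialize (h (enc 0 m) (enc 1 m) ltac:(apply enc_lt; lia) ltac:(apply enc_lt; lia)).
  simpl aview in h; rewrite !deg_root in h; specialize (h eq_refl).
  apply enc_inj in h; lia.
Qed.

(** * Displacement of walks along the ring *)

(* Ports [m] and [m + 1] occur on the ring only, so the displacement along the
   ring of a walk depends only on its port sequence. *)
Definition port_shift (p : nat) : nat :=
  if p =? m then 1 else if p =? m + 1 then k - 1 else 0.

Definition displacement (ps : list (nat * nat)) : nat :=
  list_sum (map (fun e => port_shift (fst e)) ps).

Lemma edge_shift g j p u q : 2 <= k -> g < k -> j <= m -> edge_case g j p u q ->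
  exists g' j', g' < k /\ j' <= m /\ u = enc g' j' /\
    pfun s g' = (pfun s g + port_shift p) mod k.
Proof.
  intros k2 hg hj h; pose proof (pfun_lt k s g hg) as hp.
  assert (inner : forall j', j' <= m -> p < m -> u = enc g j' ->
    exists g' j', g' < k /\ j' <= m /\ u = enc g' j' /\
      pfun s g' = (pfun s g + port_shift p) mod k).
  { intros j' hj' hpm ->; exists g, j'; repeat split; auto; unfold port_shift.
    destruct (Nat.eqb_spec p m); [lia|]; destruct (Nat.eqb_spec p (m + 1)); [lia|].
    rewrite Nat.add_0_r; symmetry; now apply Nat.mod_small. }
  destruct h.
  - apply inner with p; auto; lia.
  - exists (next g), m; repeat split; auto using next_lt.
    unfold port_shift; rewrite Nat.eqb_refl, pos_next by easy; apply wrap_mod; lia.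
  - exists (prev g), m; repeat split; auto using prev_lt.
    unfold port_shift; rewrite Nat.eqb_refl, pos_prev by easy.
    destruct (Nat.eqb_spec (m + 1) m); [lia|]; apply wrap_mod; lia.
  - apply inner with m; auto; apply digit_lt; lia.
  - pose proof (digit_lt m g j ltac:(lia)).
    apply inner with (wrap m (j + d)); auto; wrap_lia.
Qed.

Lemma last_default {T} (l : list T) x a b : last (x :: l) a = last (x :: l) b.
Proof. revert x; induction l as [|y l IH]; intros x; [easy|]; exact (IH y). Qed.

Lemma walk_shift g j ps nodes w : 2 <= k -> g < k -> j <= m ->
  walk ring_graph (enc g j) ps = Some nodes ->
  last (enc g j :: nodes) (enc g j) = w ->
  pfun s (clique_of w) = (pfun s g + displacement ps) mod k.
Proof.
  intros k2; revert g j nodes; induction ps as [|[p q] ps IH]; intros g j nodes hg hj hw hl.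
  - injection hw as <-; simpl in hl; subst w.
    rewrite clique_of_enc, Nat.add_0_r by easy.
    symmetry; apply Nat.mod_small; now apply pfun_lt.
  - cbn [walk] in hw.
    destruct (nth_error (adj ring_graph (enc g j)) p) as [[u q']|] eqn:e; [|discriminate].
    destruct (Nat.eqb q q'); [|discriminate].
    destruct (walk ring_graph u ps) as [l|] eqn:e'; [|discriminate].
    injection hw as <-.
    apply adjP in e; [|easy].
    destruct (edge_shift _ _ _ _ _ k2 hg hj e) as (g' & j' & hg' & hj' & -> & E).
    rewrite (IH _ _ _ hg' hj' e'), E.
    + unfold displacement; simpl; now rewrite Nat.Div0.add_mod_idemp_l, Nat.add_assoc.
    (* The default of [last] changes with the start of the walk, which is harmless on a nonempty
       list. *)
    + rewrite <- hl; exact (last_default l (enc g' j') _ _).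
Qed.

End RingOfCliques.

(** * Recovering the order of the cliques from the outputs *)

(** The order decides only which roots the ring ports lead to; every root has the same degree, and
    the far ports on the ring are fixed. *)
Lemma aview1_ring_graph m k (s s' : perm_below k) v : v < gn (ring_graph m k s) ->
  aview (ring_graph m k s) 1 v = aview (ring_graph m k s') 1 v.
Proof.
  intros hv; destruct (enc_surj m k s v hv) as (g & j & hg & hj & ->).
  apply aview1_ext.
  - now rewrite !deg_enc.
  - intros p x q h; apply adjP in h; [|easy].
    assert (inner : forall j', j' <= m ->
      deg (ring_graph m k s) (enc m g j') = deg (ring_graph m k s') (enc m g j')).
    { intros; now rewrite !deg_enc. }
    destruct h; eexists; (split; [apply adjP; [easy|constructor; auto]|]);
      rewrite ?deg_root; auto; apply inner; wrap_lia.
Qed.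

(* The output of the root of clique [g] determines its distance along the ring
   to the leader's clique; comparing with clique 0, whose position is known,
   gives the position of [g]. *)
Lemma same_advice_same_order m k (s s' : perm_below k) A a : 2 <= k ->
  pfun s 0 = 0 -> pfun s' 0 = 0 ->
  elects (ring_graph m k s) (output_time1 A a (ring_graph m k s)) ->
  elects (ring_graph m k s') (output_time1 A a (ring_graph m k s')) ->
  forall g, g < k -> pfun s g = pfun s' g.
Proof.
  intros k2 s0 s0' [w hw] [w' hw'].
  (* One [d] serves both graphs: equal advice and equal views give the root the same output, and [d]
     is its displacement. *)
  assert (H : forall g, g < k -> exists d,
    pfun s (clique_of m w) = (pfun s g + d) mod k /\
    pfun s' (clique_of m w') = (pfun s' g + d) mod k).
  { intros g hg.
    destruct (hw (enc m g m)) as (ps & l & e1 & e2 & _ & e3); [apply enc_lt; lia|].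
    destruct (hw' (enc m g m)) as (ps' & l' & e1' & e2' & _ & e3'); [apply enc_lt; lia|].
    unfold output_time1 in e1, e1'.
    rewrite (aview1_ring_graph m k s' s) in e1' by (apply enc_lt; lia).
    rewrite e1 in e1'; injection e1' as <-.
    exists (displacement m k ps); split; eapply walk_shift; eauto. }
  assert (E : pfun s (clique_of m w) = pfun s' (clique_of m w')).
  { destruct (H 0 ltac:(lia)) as (d & -> & ->); now rewrite s0, s0'. }
  intros g hg; destruct (H g hg) as (d & e & e'); rewrite E in e.
  apply mod_add_inj with k d; auto using pfun_lt; congruence.
Qed.

(** * Counting advice strings *)

(** Binary value, lowest bit first, with an extra top bit 1 that keeps apart strings differing by
    trailing zeros. *)
Fixpoint string_code (l : list bool) : nat :=
  match l with
  | [] => 1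
  | b :: l' => Nat.b2n b + 2 * string_code l'
  end.

Lemma string_code_pos l : 0 < string_code l.
Proof. induction l; simpl; lia. Qed.

Lemma string_code_inj l l' : string_code l = string_code l' -> l = l'.
Proof.
  revert l'; induction l as [|b l IH]; intros [|b' l'] e; cbn [string_code] in e; auto.
  - pose proof (string_code_pos l'); lia.
  - pose proof (string_code_pos l); lia.
  - destruct b, b'; simpl Nat.b2n in e; try lia; f_equal; apply IH; lia.
Qed.

Lemma string_code_lt l : string_code l < 2 ^ S (length l).
Proof.
  induction l as [|b l IH]; [simpl; lia|].
  cbn [string_code length]; rewrite Nat.pow_succ_r'; destruct b; simpl Nat.b2n; lia.
Qed.

(** Pigeonhole: strings shorter than [M] have codes in [1 .. 2 ^ M - 1], too few for [T] distinct
    strings. *)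
Lemma long_string_exists (f : nat -> list bool) T M : 2 ^ M <= T ->
  (forall x y, x < T -> y < T -> f x = f y -> x = y) ->
  exists x, x < T /\ M <= length (f x).
Proof.
  intros hT inj.
  destruct (Exists_dec (fun x => M <= length (f x)) (seq 0 T)
             (fun x => le_dec M (length (f x)))) as [h|h].
  - apply Exists_exists in h; destruct h as (x & hx & h).
    apply in_seq in hx; exists x; split; [lia|easy].
  - exfalso.
    assert (hlen : length (map (fun x => string_code (f x)) (seq 0 T)) <=
                   length (seq 1 (2 ^ M - 1))).
    { apply NoDup_incl_length.
      - apply NoDup_map_NoDup_ForallPairs; [|apply seq_NoDup].
        intros x y hx hy e; apply in_seq in hx, hy.
        apply inj; try lia; now apply string_code_inj.
      - intros c hc; apply in_map_iff in hc; destruct hc as (x & <- & hx).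
        assert (hl : length (f x) < M).
        { destruct (le_lt_dec M (length (f x))); [|easy].
          exfalso; apply h, Exists_exists; eauto. }
        pose proof (string_code_pos (f x)); pose proof (string_code_lt (f x)).
        assert (2 ^ S (length (f x)) <= 2 ^ M) by (apply Nat.pow_le_mono_r; lia).
        apply in_seq; lia. }
    rewrite length_map, !length_seq in hlen.
    assert (0 < 2 ^ M) by (apply Nat.neq_0_lt_0, Nat.pow_nonzero; lia); lia.
Qed.

Definition swap_graph (m K x : nat) (K0 : 0 < K) : pgraph :=
  ring_graph m (2 * K) (swap_perm K x K0).

(** Equal advice forces equal orders, hence equal digits and equal [x]; the advice is thus injective
    in [x]. *)
Lemma swap_graph_advice m K M (K0 : 0 < K) A adv : 2 ^ M <= K ^ (K - 1) ->
  (forall x, x < K ^ (K - 1) ->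
     elects (swap_graph m K x K0) (output_time1 A (adv (swap_graph m K x K0)) (swap_graph m K x K0))) ->
  exists x, x < K ^ (K - 1) /\ M <= length (adv (swap_graph m K x K0)).
Proof.
  intros hM hA.
  apply (long_string_exists (fun x => adv (swap_graph m K x K0))); [easy|].
  intros x y hx hy e.
  apply digit_inj with K (K - 1); auto.
  apply swaps_digits with (2 * K); [easy|lia|].
  pose proof (hA x hx) as ex; pose proof (hA y hy) as ey; rewrite <- e in ey.
  apply (same_advice_same_order m (2 * K) (swap_perm K x K0) (swap_perm K y K0) A _
    ltac:(lia) (swaps_0 _ _ _) (swaps_0 _ _ _) ex ey).
Qed.

(** * Logarithms and the choice of parameters *)

Lemma log2_pow2 a : log2 (2 ^ a) = INR a.
Proof.
  unfold log2; rewrite ln_pow by lra.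
  pose proof ln_lt_2; field; lra.
Qed.

Lemma log2_le x y : (0 < x)%R -> (x <= y)%R -> (log2 x <= log2 y)%R.
Proof.
  intros hx hxy; unfold log2; pose proof ln_lt_2.
  apply Rmult_le_compat_r.
  - left; apply Rinv_0_lt_compat; lra.
  - destruct hxy as [hxy| ->]; [left; now apply ln_increasing | apply Rle_refl].
Qed.

Lemma INR_pow2 a : INR (2 ^ a) = (2 ^ a)%R.
Proof. now rewrite pow_INR. Qed.

Lemma log2_log2_le n a : 2 <= n -> n <= 2 ^ (2 ^ a) -> (log2 (log2 (INR n)) <= INR a)%R.
Proof.
  intros h2 hn; apply le_INR in h2, hn; rewrite INR_pow2 in hn; simpl INR in h2.
  (* Monotonicity of the outer logarithm requires a positive inner one. *)
  assert (h1 : (1 <= log2 (INR n))%R).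
  { pose proof (log2_pow2 1) as e; simpl in e; rewrite <- e; apply log2_le; lra. }
  rewrite <- (log2_pow2 a), <- INR_pow2; apply log2_le; [lra|].
  rewrite <- (log2_pow2 (2 ^ a)); apply log2_le; lra.
Qed.

Theorem theorem2 :
  exists c : R, (c > 0)%R /\
  forall N : nat, exists n : nat, N <= n /\
    exists F : list pgraph,
      (forall G, In G F -> wf_graph G /\ gn G = n /\ election_index G 1) /\
      forall (A : list bool -> view -> list nat) (adv : pgraph -> list bool),
        (forall G, In G F -> elects G (output_time1 A (adv G) G)) ->
        exists G, In G F /\
          (INR (length (adv G)) >= c * INR n * log2 (log2 (INR n)))%R.
Proof.
  exists (1 / 16)%R; split; [lra|].
  (* With [m] a power of two, the number of cliques [m ^ m = 2 ^ (t * m)] is one as well, so its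
     logarithm is exact. *)
  intros N; set (t := N + 2); set (m := 2 ^ t).
  assert (htm : t + 1 <= m).
  { unfold m; pose proof (Nat.pow_gt_lin_r 2 t ltac:(lia)); lia. }
  assert (ht : 2 <= t) by lia.
  set (K := 2 ^ (t * m - 1)).
  assert (K0 : 0 < K) by (apply Nat.neq_0_lt_0, Nat.pow_nonzero; lia).
  assert (htm6 : 6 <= t * m) by nia.
  assert (hK : 2 * K = 2 ^ (t * m)).
  { unfold K; rewrite <- Nat.pow_succ_r'; f_equal; lia. }
  assert (K16 : 16 <= K).
  { unfold K; change 16 with (2 ^ 4); apply Nat.pow_le_mono_r; lia. }
  assert (hKm : 2 * K = m ^ m) by (rewrite hK; unfold m at 2; now rewrite <- Nat.pow_mul_r).
  (* This is [K * (t * m) / 2], a little over half of the logarithm [(t * m - 1) * (K - 1)] of the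
     number of graphs; [K16] and [htm6] give the slack. *)
  set (M := 2 ^ (t * m - 2) * (t * m)).
  assert (hM2 : 2 * M = K * (t * m)).
  { unfold M, K; replace (t * m - 1) with (S (t * m - 2)) by lia.
    rewrite Nat.pow_succ_r'; lia. }
  assert (hM : 2 ^ M <= K ^ (K - 1)).
  { unfold K at 1; rewrite <- Nat.pow_mul_r; apply Nat.pow_le_mono_r; [lia|].
    nia. }
  set (n := 2 * K * (m + 1)).
  exists n; split; [unfold n; nia|].
  exists (map (fun x => swap_graph m K x K0) (seq 0 (K ^ (K - 1)))); split.
  - intros G hG; apply in_map_iff in hG; destruct hG as (x & <- & _); split; [|split].
    + apply wf_ring_graph; lia.
    + reflexivity.
    + apply election_index_ring_graph; lia.
  - intros A adv hA.
    destruct (swap_graph_advice m K M K0 A adv hM) as (x & hx & hl).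
    { intros x hx; apply hA, in_map_iff; exists x; split; [easy | apply in_seq; lia]. }
    exists (swap_graph m K x K0); split.
    { apply in_map_iff; exists x; split; [easy | apply in_seq; lia]. }
    assert (hlog : (log2 (log2 (INR n)) <= INR (2 * t))%R).
    { apply log2_log2_le; [unfold n; nia|].
      replace (2 ^ (2 * t)) with (m * m)
        by (unfold m; rewrite <- Nat.pow_add_r; f_equal; lia).
      (* Here [m + 1 <= 2 ^ (t + 1)], and [t * m + t + 1 <= (t + 1) * m <= m * m] by [htm]. *)
      apply Nat.le_trans with (2 ^ (t * m + S t)).
      - rewrite Nat.pow_add_r, <- hK, Nat.pow_succ_r'; fold m; unfold n; nia.
      - apply Nat.pow_le_mono_r; nia. }
    (* From [m + 1 <= 2 * m] and [hM2]; this is the source of the constant [1 / 16]. *)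
    assert (hn : n * (2 * t) <= 16 * M) by (unfold n; nia).
    apply le_INR in hl, hn; rewrite !mult_INR in hn.
    replace (INR 16) with 16%R in hn by (simpl; lra).
    rewrite mult_INR in hlog.
    pose proof (pos_INR n); nra.
Qed.
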